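(* Let $n>0$ be an integer with binary expansion $n=\sum_{i=0}^{k}n_i2^i$, $n_i\in\{0,1\}$, $k=\lfloor\log_2(n)\rfloor$. The number $\delta(n)$ of $D$-nodes in a divide-and-conquer tree with $n$ leaf nodes is $$\delta(n)=\sum_{i=0}^{\lfloor\log_2(n)\rfloor-1}\lambda_i(n),\quad\text{where } \lambda_i(n)=\begin{cases}(n\bmod 2^i), & \text{if } n_i=0;\\ 2^i-(n\bmod 2^i), & \text{if } n_i=1.\end{cases}$$ An explicit form is $$\delta(n)=\sum_{i=0}^{\lfloor\log_2(n)\rfloor-1}\left(n_i\cdot 2^i+(-1)^{n_i}\cdot(n\bmod 2^i)\right).$$
   Context: A full binary tree is a rooted binary tree in which every interior node has exactly two children. An interior node of a full binary tree is an $S$-node if its two subtrees have the same number of leaves, and a $D$-node if its two subtrees have different numbers of leaves. A divide-and-conquer tree is a full binary tree in which the numbers of leaf descendants of the left and right children of any interior node differ by at most $1$ (a child that is a leaf counts as having one leaf). For each $n\ge 1$ there is exactly one such tree with $n$ leaves up to tree isomorphism; $\delta(n)$ denotes its number of $D$-nodes. Here $n\bmod 2^i$ is the remainder in $\{0,\dots,2^i-1\}$; empty sums are $0$. *)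

(* Defs.v *)
From mathcomp Require Import all_boot all_order all_algebra.

Set Implicit Arguments.
Unset Strict Implicit.
Unset Printing Implicit Defensive.

Inductive full_binary_tree : Type :=
| Leaf
| Node of full_binary_tree & full_binary_tree.

Fixpoint leaves (t : full_binary_tree) : nat :=
  match t with
  | Leaf => 1
  | Node l r => leaves l + leaves r
  end.

Fixpoint D_nodes (t : full_binary_tree) : nat :=
  match t with
  | Leaf => 0
  | Node l r => (leaves l != leaves r) + D_nodes l + D_nodes r
  end.

(* Subtraction on nat is truncated, so the condition that two leaf counts
   differ by at most 1 is written as two inequalities. *)
Fixpoint divide_and_conquer (t : full_binary_tree) : bool :=
  match t with
  | Leaf => true
  | Node l r =>
      [&& leaves l <= leaves r + 1, leaves r <= leaves l + 1,
          divide_and_conquer l & divide_and_conquer r]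
  end.

(* Trees here are ordered and their number of leaves does not determine them
   on the nose, only up to exchanging the children of nodes. Hence delta n is
   D_nodes t for an arbitrary divide-and-conquer tree t with n leaves; such a
   tree exists for every positive n. *)
Lemma divide_and_conquer_exists (n : nat) :
  0 < n -> exists t, divide_and_conquer t /\ leaves t = n.
Proof.
elim/ltn_ind: n => n IH n_gt0.
have [n_le1|n_gt1] := leqP n 1.
  exists Leaf; split=> //=; by apply/eqP; rewrite eqn_leq n_gt0 n_le1.
have half_gt0 : 0 < n./2 by rewrite half_gt0.
have nE : uphalf n + n./2 = n.
  by rewrite uphalf_half -addnA addnn odd_double_half.
have up_gt0 : 0 < uphalf n by rewrite uphalf_half addn_gt0 half_gt0 orbT.
have [|l [dl lE]] := IH (uphalf n) _ up_gt0.
  by rewrite -[X in _ < X]nE -[X in X < _]addn0 ltn_add2l.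
have [|r [dr rE]] := IH (n./2) _ half_gt0.
  by rewrite -[X in _ < X]nE -[X in X < _]add0n ltn_add2r.
exists (Node l r); split; last by rewrite /= lE rE.
rewrite /= lE rE dl dr !andbT uphalf_half addnC leq_add2l leq_b1 /=.
by rewrite -addnA leq_addr.
Qed.

(* d i stands for the i-th binary digit of n. *)
Definition lambda (d : nat -> nat) (n i : nat) : nat :=
  if d i == 0 then n %% 2 ^ i else 2 ^ i - n %% 2 ^ i.

(* Main.v *)
Require Import Defs.
From mathcomp Require Import all_boot all_order all_algebra.
From mathcomp Require Import zify.

(** The sizes of the subtrees at depth [i] of a divide-and-conquer tree with
    [n] leaves are as equal as possible: writing [n = q * 2 ^ i + r] with
    [r < 2 ^ i], there are [r] subtrees of size [q + 1] and [2 ^ i - r] of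
    size [q].  As long as [2 <= q], that is for [i < trunc_log 2 n], all their
    roots are interior nodes, and such a root is a [D]-node exactly when its
    size is odd.  So depth [i] contributes [r] when [q] is even and [2 ^ i - r]
    when [q] is odd, and the parity of [q] is the binary digit of weight
    [2 ^ i].  Deeper down only subtrees with one or two leaves are left, and
    these contain no [D]-node.

    In the formal argument the contribution of a depth is the function
    [depth_D i n], and the description of the subtrees at depth [i] is replaced
    by a recursion: depth [i + 1] of a tree consists of depth [i] of its two
    subtrees, hence [depth_D i.+1 (a + b) = depth_D i a + depth_D i b] when [a]
    and [b] differ by at most one ([depth_D_split]).  An induction on the
    number of depths then gives [D_nodes_depth]. *)

(** As a function of [n] this is the triangle wave of period [2 ^ i.+1]: the
    distance from [n] to the nearest multiple of [2 ^ i.+1]. *)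
Definition depth_D (i n : nat) : nat :=
  if odd (n %/ 2 ^ i) then 2 ^ i - n %% 2 ^ i else n %% 2 ^ i.

(** The triangle wave is continuous, so that its formula on a segment between
    two multiples of [2 ^ i] remains valid at the right end [r = 2 ^ i].  This
    spares a carry analysis when [n] is replaced by [n.+1]. *)
Lemma depth_D_linear i q r :
  r <= 2 ^ i -> depth_D i (q * 2 ^ i + r) = if odd q then 2 ^ i - r else r.
Proof.
have p_gt0 : 0 < 2 ^ i by rewrite expn_gt0.
rewrite leq_eqVlt => /orP[/eqP-> | lt_r].
  rewrite /depth_D -mulSnr mulnK // modnMl subn0 subnn /=.
  by case: (odd q).
by rewrite /depth_D divnMDl // modnMDl divn_small // modn_small // addn0.
Qed.

Lemma depth_D0 n : depth_D 0 n = odd n.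
Proof. by rewrite /depth_D expn0 divn1 modn1; case: (odd n). Qed.

(** [depth_D i] is affine between consecutive integers, and [depth_D i.+1] is
    its rescaling by two in both variables: its value at [a + b] is twice the
    value of [depth_D i] at the midpoint of [a] and [b]. *)
Lemma depth_D_split i a b :
  a <= b + 1 -> b <= a + 1 -> depth_D i.+1 (a + b) = depth_D i a + depth_D i b.
Proof.
wlog le_ab : a b / a <= b => [th|] leab leba.
  case: (leqP a b) => [|/ltnW] le; first exact: th.
  by rewrite addnC [RHS]addnC; apply: th.
have p_gt0 : 0 < 2 ^ i by rewrite expn_gt0.
have lt_r := ltn_pmod a p_gt0.
move: (divn_eq a (2 ^ i)) lt_r.
set q := a %/ _; set r := a %% _ => aE lt_r.
(* [e] is 0 for equal sizes and 1 otherwise; [r + e] may reach [2 ^ i]. *)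
have [e [le_e1 bE]] : exists e, e <= 1 /\ b = q * 2 ^ i + (r + e).
  by exists (b - a); lia.
have sumE : a + b = q * 2 ^ i.+1 + (r + (r + e)) by rewrite expnS; lia.
rewrite sumE bE aE !depth_D_linear ?expnS; try lia.
by case: (odd q); lia.
Qed.

Lemma leaves_gt0 t : 0 < leaves t.
Proof. by elim: t => //= l IHl r _; rewrite addn_gt0 IHl. Qed.

Lemma D_nodes_leaf t : leaves t <= 1 -> D_nodes t = 0.
Proof. by case: t => //= l r; have := leaves_gt0 l; have := leaves_gt0 r; lia. Qed.

(** The range of sizes includes both powers of two because the larger half of
    [2 ^ k.+1 - 1] is [2 ^ k]: the two subtrees of a tree may have different
    binary logarithms, and the same number [k] has to serve for both. *)
Lemma D_nodes_depth k t :
  divide_and_conquer t -> 2 ^ k <= leaves t <= 2 ^ k.+1 ->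
  D_nodes t = \sum_(0 <= i < k) depth_D i (leaves t).
Proof.
elim: k t => [|k IHk] [|l r] //=.
- by rewrite big_geq.
- case/and4P=> _ _ _ _ /andP[_ le2]; rewrite big_geq //.
  have := leaves_gt0 l; have := leaves_gt0 r.
  by move=> gr gl; rewrite (@D_nodes_leaf l) ?(@D_nodes_leaf r); lia.
- by have : 0 < 2 ^ k; [rewrite expn_gt0 | rewrite !expnS; lia].
case/and4P=> le_lr le_rl dl dr; rewrite !(expnS 2) => /andP[lo hi].
rewrite (IHk l dl) ?(IHk r dr) ?expnS; try by apply/andP; split; lia.
(* The summand for [i = 0] is the root: it is a [D]-node exactly when the sum
   of two sizes differing by at most one is odd. *)
rewrite big_nat_recl // depth_D0.
under [in RHS]eq_bigr => i _ do rewrite depth_D_split //.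
rewrite big_split /= addnA; congr (_ + _ + _).
lia.
Qed.

(** Uniqueness of the binary expansion: the lowest digit is the parity of the
    sum, and halving the sum shifts the remaining digits down by one. *)
Lemma binary_digit m (d : nat -> nat) i :
  (forall j, j < m -> d j = 0 \/ d j = 1) -> i < m ->
  d i = odd ((\sum_(0 <= j < m) d j * 2 ^ j) %/ 2 ^ i).
Proof.
elim: m d i => // m IHm d i hd lt_im.
set high := \sum_(0 <= j < m) d j.+1 * 2 ^ j.
have -> : \sum_(0 <= j < m.+1) d j * 2 ^ j = high * 2 + d 0.
  rewrite big_nat_recl // expn0 muln1 addnC big_distrl /=; congr (_ + _).
  by apply: eq_bigr => j _; rewrite expnS mulnCA mulnC.
have d0 := hd 0 isT.
case: i lt_im => [_|i lt_im].
  by rewrite divn1 oddD oddM andbF /=; case: d0 => ->.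
rewrite expnS divnMA divnMDl // (divn_small (m := d 0)) ?addn0; last first.
  by case: d0 => ->.
by rewrite /high -(IHm (fun j => d j.+1)) // => j lt_jm; apply: hd.
Qed.

Lemma lambdaZ (d : nat -> nat) n i :
  d i = 0 \/ d i = 1 ->
  ((lambda d n i)%:Z =
     (d i)%:Z * 2%:Z ^+ i + (-1) ^+ d i * (n %% 2 ^ i)%N%:Z)%R.
Proof.
have lt_mod : n %% 2 ^ i < 2 ^ i by rewrite ltn_mod expn_gt0.
rewrite /lambda => -[] ->; rewrite ?GRing.mul0r ?GRing.add0r ?GRing.expr0
  ?GRing.mul1r //=.
by rewrite GRing.expr1 GRing.mulN1r -subzn ?(ltnW lt_mod) // -natz GRing.natrX.
Qed.

Theorem theorem11 (n : nat) (hn : 0 < n) (d : nat -> nat)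
    (hd : forall i, i <= trunc_log 2 n -> d i = 0 \/ d i = 1)
    (hexp : n = \sum_(0 <= i < (trunc_log 2 n).+1) d i * 2 ^ i)
    (t : full_binary_tree) (ht : divide_and_conquer t) (hleaves : leaves t = n) :
  D_nodes t = \sum_(0 <= i < trunc_log 2 n) lambda d n i /\
  ((D_nodes t)%:Z =
     \sum_(0 <= i < trunc_log 2 n)
       ((d i)%:Z * 2%:Z ^+ i + (-1) ^+ d i * (n %% 2 ^ i)%N%:Z))%R.
Proof.
have DE : D_nodes t = \sum_(0 <= i < trunc_log 2 n) lambda d n i.
  have /andP[lo hi] := trunc_log_bounds (isT : 1 < 2) hn.
  rewrite (@D_nodes_depth (trunc_log 2 n)) // hleaves ?lo ?(ltnW hi) //.
  apply: eq_big_nat => i /andP[_ lt_i].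
  have dE : d i = odd (n %/ 2 ^ i).
    by rewrite [in RHS]hexp -binary_digit // ltnW.
  by rewrite /lambda dE /depth_D; case: (odd _).
split=> //; rewrite DE -natz GRing.natr_sum.
apply: eq_big_nat => i /andP[_ lt_i].
by rewrite natz lambdaZ //; apply: hd; apply: ltnW.
Qed.
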